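(* Let $n\ge1$ be an integer, let $0<s<n$, and let $1\le p,q\le\infty$ satisfy $$\frac1p+\frac1q=\frac sn,$$ excluding the trivial case $(p,q)=(\infty,\infty)$. Then the bilinear Bessel potential $\mathcal J_s$ does not define a bounded operator $$\mathcal J_s: L^p(\mathbb R^n)\times L^q(\mathbb R^n)\longrightarrow L^\infty(\mathbb R^n).$$
   Context: For $0<s<n$, $G_s$ denotes the Bessel kernel of order $s$ on $\mathbb R^n$: the nonnegative integrable function whose Fourier transform (with convention $\widehat{h}(\xi)=\int h(x)e^{-2\pi i x\cdot\xi}\,dx$) is $\widehat{G_s}(\xi)=(1+4\pi^2|\xi|^2)^{-s/2}$. The bilinear Bessel potential is $$\mathcal J_s(f,g)(x)=\int_{\mathbb R^n}G_s(y)\,f(x-y)\,g(x+y)\,dy .$$ Saying that $\mathcal J_s: X\times Y\to Z$ is bounded means that there is a finite constant $C$ such that, for all $f\in X$, $g\in Y$, the defining integral converges absolutely for a.e. $x$ and $\|\mathcal J_s(f,g)\|_Z\le C\|f\|_X\|g\|_Y$. Convention: $1/\infty=0$. *)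

(* Defs.v *)
From HB Require Import structures.
From mathcomp Require Import all_boot all_order all_algebra.
From mathcomp Require Import all_classical all_reals all_analysis.
From mathcomp Require Import complex.

Set Implicit Arguments.
Unset Strict Implicit.
Unset Printing Implicit Defensive.

Import Order.TTheory GRing.Theory Num.Theory.
Import numFieldNormedType.Exports.
Import Normc.

Local Open Scope classical_set_scope.
Local Open Scope ring_scope.

(* R^n is 'rV[R]_n with the sigma-algebra generated by the coordinate maps,
   i.e. the Borel sets, as the library does for n.-tuple T. *)
Fact rV_display : measure_display. Proof. exact: default_measure_display. Qed.

Section rV_measurable.
Context {R : realType}.
Variable n : nat.

Definition rV_coord (i : 'I_n) (x : 'rV[R]_n) : R := x ord0 i.

Let rV_set0 : g_sigma_preimage rV_coord set0.
Proof. exact: sigma_algebra0. Qed.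

Let rV_setC A : g_sigma_preimage rV_coord A -> g_sigma_preimage rV_coord (~` A).
Proof. exact: sigma_algebraC. Qed.

Let rV_bigcup (F : (set 'rV[R]_n)^nat) :
  (forall i, g_sigma_preimage rV_coord (F i)) ->
  g_sigma_preimage rV_coord (\bigcup_i (F i)).
Proof. exact: sigma_algebra_bigcup. Qed.

HB.instance Definition _ := @isMeasurable.Build rV_display
  'rV[R]_n (g_sigma_preimage rV_coord) rV_set0 rV_setC rV_bigcup.

End rV_measurable.

Lemma measurable_rV_coord {R : realType} n (i : 'I_n) :
  measurable_fun [set: 'rV[R]_n] (@rV_coord R n i).
Proof.
move=> _ Y mY; rewrite setTI; apply: sub_sigma_algebra => /=.
rewrite -bigcup_seq/=; exists i => /=; first by rewrite mem_index_enum.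
by exists Y => //; rewrite setTI.
Qed.

Lemma measurable_fun_rV {R : realType} d (T : measurableType d) n
    (f : T -> 'rV[R]_n) :
  (forall i, measurable_fun [set: T] (fun x => f x ord0 i)) ->
  measurable_fun [set: T] f.
Proof.
move=> mf _ A mA; rewrite setTI.
suff : g_sigma_preimage (@rV_coord R n) `<=` [set B | measurable (f @^-1` B)].
  exact.
apply: smallest_sub => /=.
  split=> /=.
  - by rewrite preimage_set0.
  - by move=> B mB; rewrite setTD -preimage_setC; exact: measurableC.
  - by move=> F mF; rewrite preimage_bigcup; exact: bigcup_measurable.
rewrite -bigcup_seq => B [i _ [C mC <-]] /=.
by rewrite setTI -[X in measurable X]setTI; exact: mf.
Qed.

Section lebesgue_rV.
Context {R : realType}.

Definition rV_cons n (x : R * 'rV[R]_n) : 'rV[R]_n.+1 :=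
  \row_i oapp (fun j => x.2 ord0 j) x.1 (unlift ord0 i).

Definition rV_uncons n (v : 'rV[R]_n.+1) : R * 'rV[R]_n :=
  (v ord0 ord0, \row_j v ord0 (lift ord0 j)).

Lemma rV_consK n : cancel (@rV_cons n) (@rV_uncons n).
Proof.
case=> a v; rewrite /rV_uncons /rV_cons; congr pair; first by rewrite mxE unlift_none.
by apply/rowP => j; rewrite !mxE liftK.
Qed.

Lemma measurable_rV_cons n : measurable_fun [set: R * 'rV[R]_n] (@rV_cons n).
Proof.
apply: measurable_fun_rV => i.
under eq_fun do rewrite mxE.
case: (unlift ord0 i) => [j|] /=; last exact: measurable_fst.
by apply: (measurableT_comp (measurable_rV_coord j)); exact: measurable_snd.
Qed.

Lemma measurable_rV_uncons n :
  measurable_fun [set: 'rV[R]_n.+1] (@rV_uncons n).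
Proof.
apply: measurable_fun_pair; first exact: measurable_rV_coord.
apply: measurable_fun_rV => j; under eq_fun do rewrite mxE.
exact: measurable_rV_coord.
Qed.

Section succ.
Variables (n : nat) (m : {sigma_finite_measure set 'rV[R]_n -> \bar R}).

(* The Lebesgue measure on R x R^n, transported to R^(n+1). *)
Definition lebesgue_rV_succ : set 'rV[R]_n.+1 -> \bar R :=
  pushforward (@lebesgue_measure R \x m)%E (@rV_cons n).

Let succ0 : lebesgue_rV_succ set0 = 0%E.
Proof. by rewrite /lebesgue_rV_succ /pushforward preimage_set0 measure0. Qed.

Let succ_ge0 A : (0 <= lebesgue_rV_succ A)%E.
Proof. by rewrite /lebesgue_rV_succ /pushforward; exact: measure_ge0. Qed.

Let succ_sigma_additive : semi_sigma_additive lebesgue_rV_succ.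
Proof.
move=> F mF tF mUF; rewrite /lebesgue_rV_succ /pushforward preimage_bigcup.
apply: measure_semi_sigma_additive.
- by move=> k; rewrite -[X in measurable X]setTI; exact: measurable_rV_cons.
- apply/trivIsetP => /= i j _ _ ij; rewrite -preimage_setI.
  by move/trivIsetP : tF => /(_ _ _ _ _ ij) ->//; rewrite preimage_set0.
- rewrite -preimage_bigcup -[X in measurable X]setTI.
  exact: measurable_rV_cons.
Qed.

HB.instance Definition _ := isMeasure.Build _ _ _ lebesgue_rV_succ
  succ0 succ_ge0 succ_sigma_additive.

Let succ_sigma_finite : sigma_finite setT lebesgue_rV_succ.
Proof.
have /sigma_finiteP[F [TF ndF Foo]] := sigma_finiteT (@lebesgue_measure R).
have /sigma_finiteP[G [TG ndG Goo]] := sigma_finiteT m.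
exists (fun k => @rV_uncons n @^-1` (F k `*` G k)).
  apply/esym/seteqP; split => // v _.
  have [i _ Fi] : (\bigcup_i F i) (v ord0 ord0) by rewrite -TF.
  have [j _ Gj] : (\bigcup_j G j) (rV_uncons v).2 by rewrite -TG.
  exists (maxn i j) => //; split => /=.
  - by move: Fi; exact/subsetPset/ndF/leq_maxl.
  - by move: Gj; exact/subsetPset/ndG/leq_maxr.
move=> k; have [mF Fk] := Foo k; have [mG Gk] := Goo k; split.
  rewrite -[X in measurable X]setTI.
  by apply: measurable_rV_uncons => //; exact: measurableX.
rewrite /lebesgue_rV_succ /pushforward -comp_preimage.
rewrite (_ : _ \o _ = id); last by apply/funext => x /=; exact: rV_consK.
rewrite preimage_id product_measure1E//.
by rewrite lte_mul_pinfty// ge0_fin_numE.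
Qed.

HB.instance Definition _ := Measure_isSigmaFinite.Build _ _ _ lebesgue_rV_succ
  succ_sigma_finite.

End succ.

(* R^0 is a point, of mass 1. *)
Fixpoint lebesgue_rV n : {sigma_finite_measure set 'rV[R]_n -> \bar R} :=
  if n is k.+1 then lebesgue_rV_succ (lebesgue_rV k)
  else @dirac _ 'rV[R]_0 0 R.

End lebesgue_rV.

Local Open Scope complex_scope.

Section complex_valued.
Context {R : realType} {n : nat}.
Local Notation mu := (@lebesgue_rV R n).
Implicit Types (f h : 'rV[R]_n -> R[i]) (p : \bar R).

(* Lebesgue integral of a complex-valued function (meaningful when |h| is
   integrable). *)
Definition cintegral h : R[i] :=
  (\int[mu]_x complex.Re (h x)) +i* (\int[mu]_x complex.Im (h x)).

Definition cmeasurable h : Prop :=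
  measurable_fun [set: 'rV[R]_n] (fun x => complex.Re (h x)) /\
  measurable_fun [set: 'rV[R]_n] (fun x => complex.Im (h x)).

Definition cLnorm p h : \bar R := Lnorm mu p (fun x => (normc (h x))%:E).

Definition cLfun p h : Prop := cmeasurable h /\ (cLnorm p h < +oo)%E.

Definition abs_convergent h : Prop :=
  cmeasurable h /\ (\int[mu]_x (normc (h x))%:E < +oo)%E.

Definition dotrV (x y : 'rV[R]_n) : R := \sum_(i < n) x ord0 i * y ord0 i.

Definition expi (t : R) : R[i] := cos t +i* sin t.

Definition fourier h (xi : 'rV[R]_n) : R[i] :=
  cintegral (fun x => h x * expi (- (2 * pi * dotrV x xi))).

End complex_valued.

Section bessel.
Context {R : realType} {n : nat}.
Local Notation mu := (@lebesgue_rV R n).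

(* These conditions determine G almost everywhere, by injectivity of the
   Fourier transform on L^1; G is real-valued, its value at the origin being
   irrelevant when the usual representative is infinite there. *)
Definition is_bessel_kernel (s : R) (G : 'rV[R]_n -> R) : Prop :=
  [/\ forall x, 0 <= G x,
      mu.-integrable setT (EFin \o G) &
      forall xi, fourier (fun x => (G x)%:C) xi =
        ((1 + 4 * pi ^+ 2 * dotrV xi xi) `^ (- (s / 2)))%:C].

Definition bilinear_integrand (G : 'rV[R]_n -> R) (f g : 'rV[R]_n -> R[i])
    (x y : 'rV[R]_n) : R[i] := (G y)%:C * f (x - y) * g (x + y).

Definition bilinear_potential (G : 'rV[R]_n -> R) (f g : 'rV[R]_n -> R[i])
    (x : 'rV[R]_n) : R[i] := cintegral (bilinear_integrand G f g x).

(* L^p x L^q -> L^r boundedness. When the potential is evaluated at one of the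
   negligibly many x where the integral diverges, Rintegral returns a junk
   value, which does not affect the (ae-invariant) norm. *)
Definition bounded_bilinear (G : 'rV[R]_n -> R) (p q r : \bar R) : Prop :=
  exists C : R, forall f g : 'rV[R]_n -> R[i], cLfun p f -> cLfun q g ->
    {ae mu, forall x, abs_convergent (bilinear_integrand G f g x)} /\
    (cLnorm r (bilinear_potential G f g) <= C%:E * (cLnorm p f * cLnorm q g))%E.

End bessel.

(* Main.v *)
Require Import Defs.
From mathcomp Require Import all_boot all_order all_algebra.
From mathcomp Require Import all_classical all_reals all_analysis.
From mathcomp Require Import complex measurable_realfun ess_sup_inf ring lra.

Import Order.TTheory GRing.Theory Num.Theory.
Import numFieldNormedType.Exports.
Import ComplexField.Normc.
Local Open Scope classical_set_scope.
Local Open Scope ring_scope.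

(** The kernel behaves like [|y|^(s-n)] near the origin, and the functions
    [|x|^(-n/p)] and [|x|^(-n/q)] miss [L^p] and [L^q] only by a logarithm; at
    [x = 0] the potential of such a pair is the integral of
    [|y|^(s-n) |y|^(-s) = |y|^(-n)], which diverges logarithmically too.  Cutting
    all three logarithms off at scale [2^-K] gives functions with norms at most
    [K^(1/p)] and [K^(1/q)], up to constants, whose potential is at least of size
    [K] on a ball of radius [2^-K].  Boundedness would then give [K <= C K^(s/n)]
    for all [K], which is absurd since [s < n].

    The cut-off functions are [bump a K], equal to [(4^-K + |x|^2)^(-na/2)] on the
    unit ball, with [a = 1/p].  Their norms come from covering the ball by dyadic
    cubes ([cLnorm_bump]).

    The lower bound on the potential ([kernel_mollified]) has to be drawn from the
    Fourier transform of [G], the only thing known about it, and it is obtained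
    without any inversion formula.  Write [Psi(u) = (1 + 4 pi^2 u)^(-s/2)], so that
    the integral of [G(y) cos(2 pi y.xi)] is [Psi(|xi|^2)].  As [Psi] is convex, the
    identity [2 cos a cos b = cos(a+b) + cos(a-b)] and the parallelogram law give,
    by induction on the number of factors,
    [int G(y) prod_v cos(2 pi y.v) dy >= Psi(sum_v |v|^2)] ([kernel_prod_phase]).
    Taking [j^2] copies of each of the vectors [(2^k/j) e_i] and letting [j] tend to
    infinity, the product falls below the Gaussian [exp(-4^k |y|^2)], whence
    [int G(y) exp(-4^k |y|^2) dy >= Psi(n 4^k)], which is comparable to [4^(-ks/2)]
    ([kernel_gauss]).  Finally [sum_(k < K) 4^(ks/2) exp(-4^k |y|^2)] is at most a
    constant times [(4^-K + |y|^2)^(-s/2)] ([sum_powR_gauss_le]), and each of its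
    [K] terms has integral against [G] bounded below. *)

(** * Inequalities for real functions *)

Lemma gt0_ler_powRN {R : realType} (a x y : R) :
  0 <= a -> 0 < x -> x <= y -> y `^ (- a) <= x `^ (- a).
Proof.
move=> a0 x0 xy; have y0 := lt_le_trans x0 xy.
rewrite !powRN lef_pV2 ?posrE ?powR_gt0 //.
by apply: ge0_ler_powR; rewrite ?nnegrE ?(ltW x0) ?(ltW y0).
Qed.

(** Any constant below [1/2] could replace [1/4]; the radius is left
    unspecified because only small angles are ever considered. *)
Lemma cos_le_gauss {R : realType} :
  exists2 d : R, 0 < d &
    forall u, `|u| <= d -> 0 <= cos u <= expR (- (u ^+ 2 / 4)).
Proof.
have [d1 /= d10 hd1] : \forall h \near (0 : R)^', 3/4 < h^-1 * sin h.
  have D : is_derive (0:R) (1:R) sin (cos 0) by exact: is_derive_sin.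
  have := @ex_derive _ _ _ _ _ _ _ D; have := @derive_val _ _ _ _ _ _ _ D.
  rewrite cos0 /derive => E /cvg_ex [l hl]; move: (hl) E.
  move=> /cvg_lim -> // E; rewrite E in hl.
  have h34 : (3/4 : R) < 1 by lra.
  have /(_ _) H := @cvgr_gt _ _ _ _ _ _ hl _ h34.
  apply: (@filterS _ (dnbhs (0 : R)) _ _ _ _ H) => h.
  by rewrite /= addr0 sin0 subr0 [h *: _]mulr1.
exists (Num.min (d1/2) 1); first by rewrite lt_min ltr01 divr_gt0.
move=> u; rewrite le_min => /andP[ud u1].
have p2 : (1:R) <= pi / 2.
  by have := @pi_ge2 R; lra.
apply/andP; split.
  by apply: cos_ge0_pihalf; move: u1; rewrite ler_norml; lra.
have [->|u0] := eqVneq u 0.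
  by rewrite cos0 expr0n /= mul0r oppr0 expR0.
apply: le_trans (expR_ge1Dx _).
(* cos u = 1 - 2 sin^2 (u / 2) *)
suff H : u ^+ 2 / 8 <= sin (u / 2) ^+ 2.
  have E : u = (u / 2) *+ 2 by rewrite -mulr_natr; field.
  rewrite [in leLHS]E cos_mulr2n cos2sin2; move: H.
  set a := sin _; rewrite -mulr_natl; lra.
have h0 : u / 2 != 0 by rewrite mulf_neq0 // invr_eq0.
have /= := hd1 (u / 2); rewrite sub0r normrN.
have -> : `|u / 2| < d1.
  rewrite normrM (@ger0_norm _ (2^-1)) ?invr_ge0 //.
  have := normr_ge0 u; lra.
move=> /(_ isT h0) H.
have : (3/4) ^+ 2 <= ((u / 2)^-1 * sin (u / 2)) ^+ 2.
  by rewrite ler_sqr ?nnegrE ?ltW //; lra.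
rewrite [leRHS]exprMn exprVn [leRHS]mulrC ler_pdivlMr; last by rewrite exprn_even_gt0.
have := sqr_ge0 u; lra.
Qed.

(** Midpoint convexity of a negative power: the geometric mean of [A] and [B]
    lies below their arithmetic mean, and the arithmetic mean of the values
    lies above their geometric mean. *)
Lemma powRN_midpoint {R : realType} (c A B : R) : 0 < A -> 0 < B -> 0 <= c ->
  ((A + B) / 2) `^ (- c) <= (A `^ (- c) + B `^ (- c)) / 2.
Proof.
move=> A0 B0 c0.
have E x : x `^ (- c) = (x `^ (- (c / 2))) ^+ 2.
  by rewrite -powR_mulrn ?powR_ge0 // -powRrM; congr (_ `^ _); field.
have M0 : 0 < (A + B) / 2 by rewrite divr_gt0 // addr_gt0.
apply: (@le_trans _ _ (A `^ (- (c / 2)) * B `^ (- (c / 2)))).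
  rewrite -powRM ?(ltW A0) ?(ltW B0) // E -powR_mulrn ?powR_ge0 // powRAC.
  rewrite powR_mulrn ?(ltW M0) //.
  apply: gt0_ler_powRN; [by rewrite divr_ge0|by rewrite mulr_gt0|].
  rewrite -subr_ge0 (_ : _ - _ = ((A - B) / 2) ^+ 2) ?sqr_ge0 //; by field.
rewrite !E; set x := A `^ _; set y := B `^ _.
have := sqr_ge0 (x - y); nra.
Qed.

Lemma pow1D_le_expR {R : realType} (n : nat) (w : R) : 0 <= w ->
  (1 + w) ^+ n <= (n.+1%:R) ^+ n * expR w.
Proof.
move=> w0.
have n0 : 0 < n.+1%:R :> R by rewrite ltr0n.
apply: (@le_trans _ _ ((n.+1%:R * expR (w / n.+1%:R)) ^+ n)).
  rewrite lerXn2r ?nnegrE ?mulr_ge0 ?expR_ge0 ?addr_ge0 ?ler0n //.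
  apply: (@le_trans _ _ (n.+1%:R * (1 + w / n.+1%:R))).
    rewrite mulrDr mulr1 mulrCA divff ?gt_eqF // mulr1 lerD2r.
    by rewrite ler1n.
  by rewrite ler_pM2l // expR_ge1Dx.
rewrite exprMn ler_pM2l ?exprn_gt0 // -expRM_natl ler_expR.
rewrite mulrCA ler_piMr // ler_pdivrMr // mul1r ler_nat leqnSn //.
Qed.

(** The summand is at most a constant times [h (4 w) - h w] at [w = 4^k u],
    where [h w = w^a / (1 + w^a)] is bounded by [1]: the sum telescopes. *)
Lemma sum_powR_gauss_le {R : realType} (a : R) : 0 < a ->
  exists2 C : R, 0 < C & forall (u : R) (K : nat), 0 < u ->
    \sum_(k < K) (4 ^+ k * u) `^ a * expR (- (4 ^+ k * u)) <= C.
Proof.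
move=> a0.
pose h (w : R) := w `^ a / (1 + w `^ a).
have h01 w : 0 <= h w <= 1.
  rewrite /h divr_ge0 ?addr_ge0 ?powR_ge0 //= ler_pdivrMr ?mul1r ?lerDr //.
  by rewrite ltr_pwDl ?powR_ge0.
have [N aN] : exists N : nat, a <= N%:R.
  exists (Num.bound a); apply/ltW; apply: le_lt_trans (archi_boundP (ltW a0)).
  by [].
(* the bound of pow1D_le_expR on (1 + w) ^+ (2 N), with (1 + w^a)^2 <= 4 (1 + w)^(2 N) *)
pose D : R := 4 * (N.*2.+1%:R) ^+ N.*2.
have D0 : 0 < D by rewrite mulr_gt0 // exprn_gt0 // ltr0n.
have wa w : 0 < w -> (1 + w `^ a) ^+ 2 <= D * expR w.
  move=> w0.
  apply: (@le_trans _ _ ((2 * (1 + w) ^+ N) ^+ 2)); last first.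
    have -> : (2 * (1 + w) ^+ N) ^+ 2 = 4 * (1 + w) ^+ N.*2.
      by rewrite exprMn -exprM muln2; congr (_ * _); ring.
    rewrite /D -mulrA ler_pM2l //.
    exact/pow1D_le_expR/ltW.
  have w1 : 1 <= 1 + w by rewrite lerDl ltW.
  rewrite lerXn2r ?nnegrE ?mulr_ge0 ?exprn_ge0 ?addr_ge0 ?powR_ge0 ?(ltW w0) //.
  have e1 : 1 <= (1 + w) ^+ N by rewrite exprn_ege1.
  have : w `^ a <= (1 + w) ^+ N.
    rewrite -powR_mulrn; last by lra.
    apply: (@le_trans _ _ ((1 + w) `^ a)); last exact: ler_powR.
    by apply: ge0_ler_powR; rewrite ?nnegrE ?(ltW a0) ?(ltW w0) //; lra.
  by lra.
pose b : R := 4 `^ a.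
have b1 : 1 < b.
  rewrite /b -[ltLHS](powRr0 4) /powR ?(eqr_nat _ 4 0) /= ltr_expR mul0r.
  by rewrite mulr_gt0 // ln_gt0 // ltr1n.
have step w : 0 < w -> w `^ a * expR (- w) <= D * b / (b - 1) * (h (4 * w) - h w).
  move=> w0; rewrite /h powRM ?(ltW w0) // -/b.
  have := wa _ w0; rewrite expRN; have := expR_gt0 w; set e := expR w.
  have := powR_gt0 a w0; set x := w `^ a => x0 e0 H.
  rewrite ler_pdivrMr //.
  have -> : D * b / (b - 1) * (b * x / (1 + b * x) - x / (1 + x)) * e
     = x * (b * (D * e)) / ((1 + x) * (1 + b * x)).
    by field; apply/and3P; split; apply: lt0r_neq0; nra.
  have p1 : 0 < 1 + x by lra.
  have p2 : 0 < 1 + b * x by nra.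
  rewrite ler_pdivlMr ?mulr_gt0 // ler_pM2l //.
  apply: (@le_trans _ _ (b * (1 + x) ^+ 2)); last by rewrite ler_pM2l //; lra.
  nra.
exists (D * b / (b - 1)); first by rewrite divr_gt0 ?mulr_gt0 //; lra.
move=> u K u0.
apply: (@le_trans _ _ (D * b / (b - 1) * (h (4 ^+ K * u) - h u))).
  elim: K => [|K IH]; first by rewrite big_ord0 expr0 mul1r subrr mulr0.
  rewrite big_ord_recr /=.
  have := step (4 ^+ K * u); rewrite mulr_gt0 ?exprn_gt0 // => /(_ isT).
  rewrite mulrA -exprS; move: IH; lra.
have /andP[P0 P1] := h01 (4 ^+ K * u); have /andP[Q0 Q1] := h01 u.
rewrite ler_piMr //; last by lra.
by rewrite divr_ge0 // ?mulr_ge0 //; lra.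
Qed.

Lemma pow4_powR {R : realType} (k : nat) (a : R) :
  (4 ^+ k) `^ a = (2 ^+ k) `^ (2 * a).
Proof.
rewrite powRrM powR_mulrn ?exprn_ge0 //; congr (_ `^ _).
by rewrite -exprM mulnC exprM; congr (_ ^+ _); rewrite expr2; ring.
Qed.

(** For [d = |x|^2], the right-hand side is a combination of indicators of balls
    of radius [2^-k]; at distance about [2^-k] from the origin the term of that
    index already suffices. *)
Lemma powRN_le_dyadic_sum {R : realType} (a d w : R) (K : nat) :
  0 <= a -> d <= 1 -> d <= w -> 4 ^- K <= w ->
  w `^ (- a) <= \sum_(k < K.+1) (4 ^+ k.+1) `^ a * (d <= 4 ^- k)%R%:R.
Proof.
move=> a0 d1 dw.
have lew (k : nat) : 4 ^- k <= w -> w `^ (- a) <= (4 ^+ k) `^ a.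
  move=> kw; have k0 : 0 < 4 ^- k :> R by rewrite invr_gt0 exprn_gt0.
  have -> : (4 ^+ k) `^ a = (4 ^- k) `^ (- a).
    by rewrite -powR_inv1 ?exprn_ge0 // -powRrM mulrNN mul1r.
  exact: gt0_ler_powRN.
elim: K => [|K IH] Kw.
  rewrite big_ord1 /= expr0 invr1 d1 mulr1.
  apply: le_trans (lew _ Kw) _.
  by apply: ge0_ler_powR; rewrite ?nnegrE ?expr0 ?expr1 //; lra.
rewrite big_ord_recr /=; have [K'w|wK] := leP (4 ^- K) w.
  by apply: le_trans (IH K'w) _; rewrite lerDl mulr_ge0 ?powR_ge0.
apply: le_trans (lew _ Kw) _.
rewrite big_ord_recr /= (le_trans dw (ltW wK)) mulr1.
rewrite -addrA addrCA lerDl addr_ge0 ?mulr_ge0 ?powR_ge0 //.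
by apply: sumr_ge0 => i _; rewrite mulr_ge0 ?powR_ge0.
Qed.

Lemma sublinear_lt_linear {R : realType} (c r B C m : R) :
  0 < c -> 0 <= r < 1 -> 0 < m ->
  exists K : nat, C * (m * K.+1%:R) `^ r < c * K%:R - B.
Proof.
move=> c0 /andP[r0 r1] m0.
have r10 : 0 < 1 - r by lra.
pose M := (`|C| * m `^ r + c + `|B| + 1) / c.
have M0 : 0 < M.
  rewrite divr_gt0 //; have := normr_ge0 B.
  have : 0 <= `|C| * m `^ r by rewrite mulr_ge0 ?powR_ge0.
  lra.
exists (Num.bound (M `^ (1 - r)^-1)); set K := Num.bound _.
have K1 : M `^ (1 - r)^-1 < K.+1%:R.
  apply: lt_le_trans (archi_boundP (powR_ge0 _ _)) _.
  by rewrite ler_nat.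
have x1 : 1 <= K.+1%:R :> R by rewrite ler1n.
move: K1 x1; rewrite -addn1 natrD; set x : R := K%:R + 1 => K1 x1.
have x0 : 0 < x by lra.
have MK : M < x `^ (1 - r).
  have ME : M = (M `^ (1 - r)^-1) `^ (1 - r).
    by rewrite -powRrM mulVf ?(gt_eqF r10) // powRr1 // ltW.
  by rewrite [ltLHS]ME gt0_ltr_powR // ?nnegrE ?powR_ge0 ?(ltW x0).
have y1 : 1 <= x `^ r by rewrite -(powRr0 x) ler_powR.
have xE : x = x `^ (1 - r) * x `^ r.
  rewrite -powRD; last by rewrite (gt_eqF x0) implybT.
  by rewrite subrK powRr1 // ltW.
rewrite powRM ?(ltW m0) ?(ltW x0) //.
have -> : K%:R = x - 1 by rewrite /x addrK.
apply: (@le_lt_trans _ _ (`|C| * m `^ r * x `^ r)).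
  by rewrite mulrA ler_wpM2r ?powR_ge0 // ler_wpM2r ?powR_ge0 // ler_norm.
move: MK; rewrite /M ltr_pdivrMr // => MK.
have : (`|C| * m `^ r + c + `|B| + 1) * x `^ r < c * x.
  have -> : c * x = (x `^ (1 - r) * c) * x `^ r by rewrite mulrAC -xE mulrC.
  by rewrite ltr_pM2r ?powR_gt0.
have := ler_norm B; have := normr_ge0 B; move: y1.
set p := `|C| * _; nra.
Qed.

(** * Geometry and Lebesgue measure of R^n *)

Section geometry.
Context {R : realType} {n : nat}.
Implicit Types x y u v : 'rV[R]_n.

Lemma dotrVDl x y v : dotrV (x + y) v = dotrV x v + dotrV y v.
Proof.
by rewrite /dotrV -big_split; apply: eq_bigr => i _; rewrite mxE mulrDl.
Qed.

Lemma dotrVC x y : dotrV x y = dotrV y x.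
Proof. by apply: eq_bigr => i _; rewrite mulrC. Qed.

Lemma dotrVDr x y v : dotrV v (x + y) = dotrV v x + dotrV v y.
Proof. by rewrite dotrVC dotrVDl !(dotrVC v). Qed.

Lemma dotrVNr x y : dotrV x (- y) = - dotrV x y.
Proof.
by rewrite /dotrV -sumrN; apply: eq_bigr => i _; rewrite mxE mulrN.
Qed.

Lemma dotrV0 x : dotrV x 0 = 0.
Proof. by apply: big1 => i _; rewrite mxE mulr0. Qed.

Lemma dotrV_ge0 x : 0 <= dotrV x x.
Proof. by apply: sumr_ge0 => i _; rewrite -expr2 sqr_ge0. Qed.

Lemma dotrV_parallelogram x y :
  dotrV (x + y) (x + y) + dotrV (x - y) (x - y) = 2 * (dotrV x x + dotrV y y).
Proof.
rewrite !(dotrVDl, dotrVDr, dotrVNr) !(dotrVC (- y)) !(dotrVDl, dotrVDr, dotrVNr).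
by rewrite (dotrVC y x); ring.
Qed.

(** A Boolean chooses between the sum and the difference, so that both follow
    from the parallelogram law at once. *)
Lemma dotrVDB_le (e : bool) x y :
  dotrV (x + (-1) ^+ e *: y) (x + (-1) ^+ e *: y) <= 2 * (dotrV x x + dotrV y y).
Proof.
rewrite -dotrV_parallelogram; case: e; rewrite ?expr1 ?scaleN1r ?expr0 ?scale1r.
  by rewrite lerDr dotrV_ge0.
by rewrite lerDl dotrV_ge0.
Qed.

Lemma sqr_coord_le_dotrV x i : x ord0 i ^+ 2 <= dotrV x x.
Proof.
rewrite /dotrV (bigD1 i) //= -expr2 lerDl.
by apply: sumr_ge0 => j _; rewrite -expr2 sqr_ge0.
Qed.

Lemma measurable_dotrV d (T : measurableType d) (f g : T -> 'rV[R]_n) :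
  measurable_fun setT f -> measurable_fun setT g ->
  measurable_fun setT (fun t => dotrV (f t) (g t)).
Proof.
move=> mf mg; apply: measurable_sum => i.
by apply: measurable_funM; apply: (measurableT_comp (measurable_rV_coord i)).
Qed.

Lemma measurable_rVD d (T : measurableType d) (f g : T -> 'rV[R]_n) :
  measurable_fun setT f -> measurable_fun setT g ->
  measurable_fun setT (fun t => f t + g t).
Proof.
move=> mf mg; apply: measurable_fun_rV => i; under eq_fun do rewrite mxE.
by apply: measurable_funD; apply: (measurableT_comp (measurable_rV_coord i)).
Qed.

Lemma measurable_rVN d (T : measurableType d) (f : T -> 'rV[R]_n) :
  measurable_fun setT f -> measurable_fun setT (fun t => - f t).
Proof.
move=> mf; apply: measurable_fun_rV => i; under eq_fun do rewrite mxE.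
by apply: measurableT_comp => //; apply: (measurableT_comp (measurable_rV_coord i)).
Qed.

End geometry.

Definition cube {R : realType} n (r : R) : set 'rV[R]_n :=
  [set x | forall i, `|x ord0 i| <= r].

Lemma measurable_cube {R : realType} n (r : R) : measurable (cube n r).
Proof.
have -> : cube n r = \bigcap_(i in setT) [set x | `|x ord0 i| <= r].
  by apply/seteqP; split => x /= h i => [_|]; exact: h.
apply: fin_bigcap_measurable => // i _.
rewrite -[X in measurable X]setTI; apply: measurable_fun_le => //.
by apply: measurableT_comp => //; exact: measurable_rV_coord.
Qed.

Lemma lebesgue_cube {R : realType} n (r : R) : 0 < r ->
  lebesgue_rV n (cube n r) = ((2 * r) ^+ n)%:E.
Proof.
move=> r0; elim: n => [|n IH].
  by rewrite /= diracE expr0 mem_set // => -[].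
have E : @rV_cons R n @^-1` cube n.+1 r = `[- r, r] `*` cube n r.
  apply/seteqP; split => -[a x] /= h.
    split => [|i]; last first.
      by have := h (lift ord0 i); rewrite mxE liftK.
    by have := h ord0; rewrite mxE unlift_none /= in_itv /= ler_norml.
  case: h => a1 h i; rewrite mxE; case: unliftP => [j _|_] /=; first exact: h.
  by move: a1; rewrite in_itv /= ler_norml.
rewrite /= /lebesgue_rV_succ /pushforward E product_measure1E //; last first.
  exact: measurable_cube.
rewrite IH exprS EFinM; congr (_ * _)%E.
have : lebesgue_measure `[- r, r]%classic = (2 * r)%:E.
  rewrite lebesgue_measure_itv /= lte_fin ifT; last by lra.
  by rewrite -EFinD; congr (_%:E); ring.
exact.
Qed.

Lemma lebesgue_rV_gt0 {R : realType} n :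
  (0 < lebesgue_rV n [set: 'rV[R]_n])%E.
Proof.
apply: (@lt_le_trans _ _ (lebesgue_rV n (cube n 1))).
  by rewrite lebesgue_cube // lte_fin exprn_gt0 // mulr_gt0.
by apply: le_measure; rewrite ?inE //; exact: measurable_cube.
Qed.

(** * The test functions and their norms *)

Section test_functions.
Context {R : realType} {n : nat}.
Local Notation mu := (@lebesgue_rV R n).
Implicit Types x : 'rV[R]_n.

(** The square of the distance to the origin, cut off at scale [2^-K]. *)
Definition mollified K x : R := 4 ^- K + dotrV x x.

Lemma mollified_gt0 K x : 0 < mollified K x.
Proof.
by rewrite /mollified ltr_pwDl ?dotrV_ge0 // invr_gt0 exprn_gt0.
Qed.

Lemma measurable_mollified K : measurable_fun setT (mollified K).
Proof. by apply: measurable_funD => //; exact: measurable_dotrV. Qed.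

Lemma measurable_mollified_powR K a :
  measurable_fun setT (fun x => mollified K x `^ a).
Proof.
exact: (measurableT_comp (measurable_powR _) (measurable_mollified K)).
Qed.

Lemma mollified_powRN_le K a x : 0 <= a ->
  mollified K x `^ (- a) <= (4 ^- K) `^ (- a).
Proof.
move=> a0; apply: gt0_ler_powRN => //.
by rewrite /mollified lerDl dotrV_ge0.
Qed.

(** The exponent is chosen so that [|bump (1/p) K|^p = bump 1 K]. *)
Definition bump (a : R) K x : R :=
  mollified K x `^ (- (n%:R * a / 2)) * (dotrV x x <= 1)%R%:R.

Lemma bump_ge0 a K x : 0 <= bump a K x.
Proof. by rewrite mulr_ge0 ?powR_ge0. Qed.

Lemma measurable_bump a K : measurable_fun setT (bump a K).
Proof.
apply: measurable_funM.
  exact: measurable_mollified_powR.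
have mb : measurable_fun [set: bool] (fun b => b%:R : R) by [].
apply: (measurableT_comp mb).
by apply: measurable_fun_ler => //; exact: measurable_dotrV.
Qed.

(** Each of the [K + 1] dyadic scales contributes the same amount: the height
    [2^(n(k+1))] compensates the volume [(2 * 2^-k)^n] of the cube. *)
Lemma integral_bump1 K : (\int[mu]_x (bump 1 K x)%:E <= (4 ^+ n * K.+1%:R)%:E)%E.
Proof.
pose c (k : nat) : R := (4 ^+ k.+1) `^ (n%:R * 1 / 2).
pose g (k : nat) x : \bar R := ((c k)%:E * (\1_(cube n (2 ^- k)) x)%:E)%E.
have mg k : measurable_fun setT (g k).
  apply: measurable_funeM; apply/measurable_EFinP.
  by apply: measurable_indic; exact: measurable_cube.
have g0 k x : (0 <= g k x)%E by rewrite mule_ge0 // lee_fin ?powR_ge0.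
apply: (@le_trans _ _ (\int[mu]_x (\sum_(k < K.+1) g k x)))%E.
  apply: ge0_le_integral => //.
  - by move=> x _; rewrite lee_fin bump_ge0.
  - by apply/measurable_EFinP; exact: measurable_bump.
  - by apply: emeasurable_sum.
  move=> x _; under eq_bigr do rewrite /g -EFinM.
  rewrite sumEFin lee_fin /bump.
  have [d1|_] := leP (dotrV x x) 1; last first.
    by rewrite mulr0 sumr_ge0 // => i _; rewrite mulr_ge0 ?powR_ge0.
  rewrite (mulr1 (_ `^ _)).
  have dw : dotrV x x <= mollified K x by rewrite lerDr invr_ge0 exprn_ge0.
  have Kw : 4 ^- K <= mollified K x by rewrite lerDl dotrV_ge0.
  have a0 : 0 <= n%:R * 1 / 2 :> R by rewrite divr_ge0 // mulr_ge0.
  apply: le_trans (powRN_le_dyadic_sum _ _ _ _ a0 d1 dw Kw) _.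
  apply: ler_sum => k _; rewrite ler_wpM2l ?powR_ge0 // indicE ler_nat.
  have [dk|//] := leP (dotrV x x) (4 ^- k).
  rewrite mem_set // => i; rewrite -ler_sqr ?nnegrE ?invr_ge0 ?exprn_ge0 //.
  rewrite real_normK ?num_real // (le_trans (sqr_coord_le_dotrV x i)) //.
  rewrite (le_trans dk) // le_eqVlt; apply/orP; left; apply/eqP.
  by rewrite exprVn -exprM mulnC exprM; congr ((_ ^+ _)^-1); ring.
rewrite (@ge0_integral_sum _ _ _ mu _ _ _ (fun k : 'I_K.+1 => g k)) //.
rewrite (eq_bigr (fun=> (4 ^+ n)%:E)) => [|k _].
  by rewrite sumEFin lee_fin sumr_const card_ord -[leLHS]mulr_natr.
rewrite /g ge0_integralZl_EFin ?powR_ge0 //; last first.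
  apply/measurable_EFinP/measurable_indic; exact: measurable_cube.
rewrite integral_indic ?setIT //; last exact: measurable_cube.
transitivity ((c k)%:E * ((2 * 2 ^- k) ^+ n)%:E)%E.
  by congr (_ * _)%E; apply: lebesgue_cube; rewrite invr_gt0 exprn_gt0.
rewrite -EFinM; congr (_%:E).
rewrite /c pow4_powR (_ : 2 * _ = n%:R); last by field.
rewrite powR_mulrn ?exprn_ge0 // -exprMn; congr (_ ^+ _).
by rewrite exprS mulrACA divff ?expf_neq0 //; ring.
Qed.

(** For [p] infinite the exponent vanishes and [bump 0 K] is the indicator of the
    unit ball. *)
Lemma cLnorm_bump (p : \bar R) K : (1 <= p)%E ->
  (cLnorm p (fun x => (bump (fine p^-1%E) K x)%:C)%C <=
    ((4 ^+ n * K.+1%:R) `^ fine p^-1%E)%:E)%E.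
Proof.
have nC (r : R) : normc r%:C%C = `|r| by rewrite /= expr0n addr0 sqrtr_sqr.
rewrite /cLnorm (@eq_Lnorm _ _ _ mu p _ (fun x => `|bump (fine p^-1%E) K x|%:E));
  last by move=> x; rewrite nC.
case: p => [r||//]; last first.
  move=> _; rewrite unlock lebesgue_rV_gt0 invey /= powRr0.
  apply/ess_supP; apply: aeW => x /=.
  rewrite !ger0_norm ?lee_fin ?bump_ge0 //.
  by rewrite /bump mulr0 mul0r oppr0 powRr0 mul1r lern1 leq_b1.
rewrite lee_fin => r1; have r0 : 0 < r by lra.
rewrite inver (gt_eqF r0) /= unlock.
have -> : (\int[mu]_x (`|(`|bump r^-1 K x|)%:E| `^ r) = \int[mu]_x (bump 1 K x)%:E)%E.
  apply: eq_integral => x _ /=; rewrite !ger0_norm ?bump_ge0 //.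
  congr (_%:E); rewrite /bump; case: leP => _; last first.
    by rewrite !mulr0 powR0 // gt_eqF.
  by rewrite !mulr1 -powRrM; congr (_ `^ _); field; rewrite gt_eqF.
have I0 : (0 <= \int[mu]_x (bump 1 K x)%:E)%E.
  by apply: integral_ge0 => x _; rewrite lee_fin bump_ge0.
have := integral_bump1 K; move: I0; case: (\int[mu]_x _)%E => //= t.
rewrite !lee_fin => t0 tK; rewrite ge0_ler_powR ?invr_ge0 ?(ltW r0) //.
by rewrite nnegrE (le_trans t0 tK).
Qed.

Lemma bump_le_powR (a : R) K x : 0 <= a ->
  bump a K x <= (4 ^- K) `^ (- (n%:R * a / 2)).
Proof.
move=> a0; apply: (@le_trans _ _ (mollified K x `^ (- (n%:R * a / 2)))).
  by rewrite /bump ler_piMr ?powR_ge0 // lern1 leq_b1.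
by apply: mollified_powRN_le; rewrite divr_ge0 // mulr_ge0.
Qed.

Lemma cLfun_bump (p : \bar R) K : (1 <= p)%E ->
  cLfun p (fun x => (bump (fine p^-1%E) K x)%:C)%C.
Proof.
move=> p1; split; last by apply: le_lt_trans (cLnorm_bump _ _ p1) (ltry _).
by split => //=; exact: measurable_bump.
Qed.

End test_functions.

(** * Lower bounds for integrals against the kernel *)

Section frequencies.
Context {R : realType} {n : nat}.

Definition phase (y v : 'rV[R]_n) : R := cos (2 * pi * dotrV y v).

Lemma measurable_phase v : measurable_fun setT (phase ^~ v).
Proof.
have mcos : measurable_fun setT (@cos R).
  by apply: continuous_measurable_fun; exact: continuous_cos.
apply: (measurableT_comp mcos).
by apply: measurable_funM => //; apply: measurable_dotrV.
Qed.

Lemma measurable_prod_phase vs : measurable_fun setT (fun y => \prod_(v <- vs) phase y v).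
Proof. by apply: measurable_prod => v _; exact: measurable_phase. Qed.

Lemma norm_prod_phase vs y : `|\prod_(v <- vs) phase y v| <= 1.
Proof.
rewrite normr_prod; apply: prodr_ile1 => v _.
by rewrite normr_ge0 cos_max.
Qed.

Definition gauss k (y : 'rV[R]_n) : R := expR (- (4 ^+ k * dotrV y y)).

Lemma measurable_gauss k : measurable_fun setT (gauss k).
Proof.
apply: (measurableT_comp (@measurable_expR R)).
apply: measurable_funN; apply: measurable_funM => //.
exact: measurable_dotrV.
Qed.

Lemma gauss_bounds k y : 0 < gauss k y <= 1.
Proof.
by rewrite expR_gt0 expR_le1 oppr_le0 mulr_ge0 ?exprn_ge0 ?dotrV_ge0.
Qed.

(** [(j+1)^2] copies of [2^k / (j+1)] times each vector of the standard basis;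
    the shift avoids a division by zero. *)
Definition freq k j : seq 'rV[R]_n :=
  [seq (2 ^+ k / j.+1%:R) *: delta_mx ord0 i | i <- index_enum 'I_n,
                                          l <- index_iota 0 (j.+1 ^ 2)].

Lemma sum_freq k j : \sum_(v <- freq k j) dotrV v v = n%:R * 4 ^+ k.
Proof.
rewrite big_allpairs_dep (eq_bigr (fun=> 4 ^+ k)) => [|i _].
  by rewrite sumr_const card_ord mulr_natl.
rewrite sumr_const_nat subn0.
have -> : dotrV ((2 ^+ k / j.+1%:R) *: delta_mx ord0 i)
    ((2 ^+ k / j.+1%:R) *: delta_mx ord0 i) = (2 ^+ k / j.+1%:R) ^+ 2 :> R.
  rewrite /dotrV (bigD1 i) //= big1 => [|l li]; last first.
    by rewrite !mxE (negbTE li) andbF mulr0 mul0r.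
  by rewrite !mxE !eqxx mulr1 addr0 expr2.
rewrite -[LHS]mulr_natr natrX -exprMn divfK ?pnatr_eq0 //.
by rewrite -exprM mulnC exprM; congr (_ ^+ _); ring.
Qed.

Lemma prod_freq k j y : \prod_(v <- freq k j) phase y v =
  \prod_i cos (2 * pi * (2 ^+ k / j.+1%:R * y ord0 i)) ^+ (j.+1 ^ 2).
Proof.
rewrite big_allpairs_dep; apply: eq_bigr => i _.
rewrite prodr_const_nat subn0; congr (cos (_ * _) ^+ _).
rewrite /dotrV (bigD1 i) //= big1 => [|l li]; last first.
  by rewrite !mxE (negbTE li) andbF !mulr0.
by rewrite !mxE !eqxx mulr1 addr0 mulrC.
Qed.

(** Eventually all the angles are small, and then
    [cos u ^ (j+1)^2 <= exp (- (j+1)^2 u^2 / 4) = exp (- pi^2 4^k y_i^2)]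
    for each coordinate. *)
Lemma prod_freq_le_gauss k y :
  \forall j \near \oo, \prod_(v <- freq k j) phase y v <= gauss k y.
Proof.
have [d d0 cosd] := @cos_le_gauss R.
pose B := 2 * pi * 2 ^+ k * (1 + dotrV y y) / d.
have pi2 := @pi_ge2 R.
have pi0 := @pi_gt0 R.
(* d is the angle up to which cosd holds, and |y_i| <= 1 + |y|^2 for every i *)
near=> j; have jB : B <= j%:R by near: j; exact: nbhs_infty_ger.
rewrite prod_freq /gauss /dotrV mulr_sumr -sumrN expR_sum.
apply: ler_prod => i _; set u := 2 * pi * _.
have j0 : 0 < j.+1%:R :> R by rewrite ltr0n.
have ud : `|u| <= d.
  have yi : `|y ord0 i| <= 1 + dotrV y y.
    have := sqr_coord_le_dotrV y i; rewrite -(real_normK (num_real _)).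
    have := sqr_ge0 (`|y ord0 i| - 1); have := normr_ge0 (y ord0 i).
    set a := `|_|; nra.
  have -> : u = 2 * pi * 2 ^+ k * y ord0 i / j.+1%:R by rewrite /u; ring.
  have c0 : 0 <= 2 * pi * 2 ^+ k :> R by rewrite !mulr_ge0 // ltW.
  rewrite normrM normfV (ger0_norm (ltW j0)) normrM (ger0_norm c0).
  rewrite ler_pdivrMr // [leRHS]mulrC -ler_pdivrMr //.
  apply: (@le_trans _ _ B); last by apply: le_trans jB _; rewrite ler_nat.
  by rewrite /B ler_pM2r ?invr_gt0 // ler_wpM2l.
have /andP[c0 ce] := cosd _ ud.
rewrite exprn_ge0 //= (le_trans (lerXn2r _ _ _ ce)) ?nnegrE ?expR_ge0 //.
rewrite -expRM_natl ler_expR mulrN lerN2 /u natrX.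
have -> : j.+1%:R ^+ 2 * ((2 * pi * (2 ^+ k / j.+1%:R * y ord0 i)) ^+ 2 / 4)
   = pi ^+ 2 * (4 ^+ k * (y ord0 i * y ord0 i)) :> R.
  have -> : 4 ^+ k = (2 ^+ k) ^+ 2 :> R.
    by rewrite -exprM mulnC exprM; congr (_ ^+ _); ring.
  by field; rewrite gt_eqF.
apply: ler_peMl; first by rewrite mulr_ge0 ?exprn_ge0 // -expr2 sqr_ge0.
by rewrite exprn_ege1 //; lra.
Unshelve. all: by end_near.
Qed.

End frequencies.

Section kernel.
Context {R : realType} {n : nat} (s : R) (G : 'rV[R]_n -> R).
Context (s0 : 0 < s) (GP : is_bessel_kernel s G).
Local Notation mu := (@lebesgue_rV R n).

Let G0 y : 0 <= G y. Proof. by case: GP. Qed.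
Let iG : mu.-integrable setT (EFin \o G). Proof. by case: GP. Qed.

Lemma integrable_kernelM (b : 'rV[R]_n -> R) (M : R) :
  measurable_fun setT b -> (forall y, `|b y| <= M) ->
  mu.-integrable setT (EFin \o (fun y => G y * b y)).
Proof.
move=> mb bM.
have := @integrableMl _ _ _ mu _ measurableT (EFin \o G) b iG mb; apply.
exists M; split; first exact: num_real.
by move=> x Mx y _; exact: le_trans (bM y) (ltW Mx).
Qed.

Lemma integrable_kernel_gauss k :
  mu.-integrable setT (EFin \o (fun y => G y * gauss k y)).
Proof.
apply: (integrable_kernelM _ 1); first exact: measurable_gauss.
by move=> y; have /andP[g0 g1] := gauss_bounds k y; rewrite ger0_norm // ltW.
Qed.

Lemma integrable_kernel_mollified K : mu.-integrable setT
  (EFin \o (fun y => G y * mollified K y `^ (- (s / 2)))).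
Proof.
apply: (integrable_kernelM _ ((4 ^- K) `^ (- (s / 2)))) => [|y].
  exact: measurable_mollified_powR.
by rewrite ger0_norm ?powR_ge0 // mollified_powRN_le // divr_ge0 // ltW.
Qed.

Definition bessel_symbol (u : R) : R := (1 + 4 * pi ^+ 2 * u) `^ (- (s / 2)).

Lemma kernel_cos xi :
  (\int[mu]_y (G y * cos (2 * pi * dotrV y xi)))%R = bessel_symbol (dotrV xi xi).
Proof.
case: GP => _ _ /(_ xi); rewrite /fourier /cintegral.
rewrite /bessel_symbol => /(congr1 (@complex.Re R)) /= <-.
by apply: eq_Rintegral => y _; rewrite /= mul0r subr0 cosN.
Qed.

Lemma bessel_base_gt0 u : 0 <= u -> 0 < 1 + 4 * pi ^+ 2 * u :> R.
Proof.
by move=> u0; rewrite ltr_pwDl // mulr_ge0 // mulr_ge0 // sqr_ge0.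
Qed.

Lemma bessel_symbol_midpoint u v : 0 <= u -> 0 <= v ->
  bessel_symbol ((u + v) / 2) <= (bessel_symbol u + bessel_symbol v) / 2.
Proof.
move=> u0 v0; rewrite /bessel_symbol.
have -> : 1 + 4 * pi ^+ 2 * ((u + v) / 2) =
  ((1 + 4 * pi ^+ 2 * u) + (1 + 4 * pi ^+ 2 * v)) / 2 :> R by field.
apply: powRN_midpoint; [exact: bessel_base_gt0|exact: bessel_base_gt0|].
by rewrite divr_ge0 // ltW.
Qed.

(** Jensen's inequality in disguise: the product of cosines is the average of
    [cos (2 pi y.(xi +- v_1 +- ... +- v_m))] over the signs, and the average of
    [|xi +- v_1 +- ... +- v_m|^2] is the argument of the symbol on the left. *)
Lemma kernel_prod_phase vs xi :
  bessel_symbol (dotrV xi xi + \sum_(v <- vs) dotrV v v) <=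
  (\int[mu]_y (G y * (phase y xi * \prod_(v <- vs) phase y v)))%R.
Proof.
elim: vs xi => [|v vs IH] xi.
  rewrite big_nil addr0 -kernel_cos; under [leRHS]eq_Rintegral do rewrite big_nil mulr1.
  exact: lexx.
rewrite !big_cons; set S := \sum_(w <- vs) _.
have S0 : 0 <= S by apply: sumr_ge0 => w _; exact: dotrV_ge0.
have I vs' w : mu.-integrable setT
    (EFin \o (fun y => G y * (phase y w * \prod_(v <- vs') phase y v))).
  apply: (integrable_kernelM _ 1).
    apply: measurable_funM; first exact: measurable_phase.
    exact: measurable_prod_phase.
  by move=> y; rewrite normrM mulr_ile1 ?norm_prod_phase ?cos_max.
have := lerD (IH (xi + v)) (IH (xi - v)); rewrite -RintegralD // -/S.
have -> : (\int[mu]_y (G y * (phase y (xi + v) * \prod_(v <- vs) phase y v) +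
    G y * (phase y (xi - v) * \prod_(v <- vs) phase y v)))%R =
  2 * (\int[mu]_y (G y * (phase y xi * \prod_(v <- v :: vs) phase y v)))%R.
  rewrite -RintegralZl //; apply: eq_Rintegral => y _ /=.
  rewrite big_cons /phase !dotrVDr dotrVNr.
  by rewrite !mulrDr cosD mulrN cosB; ring.
have := bessel_symbol_midpoint _ _ (addr_ge0 (dotrV_ge0 (xi + v)) S0)
  (addr_ge0 (dotrV_ge0 (xi - v)) S0).
rewrite (_ : (_ + _) / 2 = dotrV xi xi + (dotrV v v + S)); first by lra.
by rewrite addrACA dotrV_parallelogram; field.
Qed.

(** The products of cosines eventually lie below the Gaussian, but at a rate that
    depends on [y]; replacing them by their maximum with the Gaussian only
    increases the integral and lets dominated convergence apply. *)
Lemma kernel_gauss k :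
  bessel_symbol (n%:R * 4 ^+ k) <= (\int[mu]_y (G y * gauss k y))%R.
Proof.
pose psi j (y : 'rV[R]_n) : R := Num.max (\prod_(v <- freq k j) phase y v) (gauss k y).
have mpsi j : measurable_fun setT (psi j).
  by apply: measurable_maxr; [exact: measurable_prod_phase|exact: measurable_gauss].
have psi1 j y : `|psi j y| <= 1.
  have /andP[g0 g1] := gauss_bounds k y.
  rewrite ger0_norm; last by rewrite le_max (ltW g0) orbT.
  by rewrite ge_max g1 (le_trans (ler_norm _)) ?norm_prod_phase.
have ipsi j := integrable_kernelM _ _ (mpsi j) (psi1 j).
have igauss := integrable_kernel_gauss k.
have lb j : bessel_symbol (n%:R * 4 ^+ k) <= (\int[mu]_y (G y * psi j y))%R.
  have := kernel_prod_phase (freq k j) 0; rewrite sum_freq.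
  rewrite dotrV0 add0r => /le_trans; apply; apply: le_Rintegral => //.
    apply: (integrable_kernelM _ 1).
      apply: measurable_funM; first exact: measurable_phase.
      exact: measurable_prod_phase.
    by move=> y; rewrite normrM mulr_ile1 ?norm_prod_phase ?cos_max.
  move=> y _; rewrite ler_wpM2l //.
  by rewrite /phase dotrV0 mulr0 cos0 mul1r le_max lexx.
have cv0 : {ae mu, forall y, setT y ->
    (G y * psi j y)%:E @[j --> \oo] --> (G y * gauss k y)%:E}.
  apply: aeW => y _; apply: cvg_near_cst.
  apply: filterS (prod_freq_le_gauss k y) => j psig.
  by rewrite /psi max_r.
have dom : {ae mu, forall y j, setT y -> (`|(G y * psi j y)%:E| <= (EFin \o G) y)%E}.
  apply: aeW => y j _; rewrite lee_fin normrM (ger0_norm (G0 y)).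
  by rewrite ler_piMr.
have [_ _ cv] := dominated_convergence measurableT
  (fun j => measurable_int _ (ipsi j)) (measurable_int _ igauss) cv0 iG dom.
rewrite -lee_fin fineK; last exact: integrable_fin_num.
rewrite -(cvg_lim _ cv) //; apply: lime_ge; first by apply/cvg_ex; eexists; exact: cv.
apply: nearW => j; rewrite -[leRHS]fineK; last exact: integrable_fin_num.
by rewrite lee_fin; exact: lb.
Qed.

Lemma kernel_sum_gauss K :
  K%:R * bessel_symbol n%:R <=
  (\int[mu]_y (G y * \sum_(k < K) (4 ^+ k) `^ (s / 2) * gauss k y))%R.
Proof.
have c0 k : 0 <= (4 ^+ k) `^ (s / 2) :> R by exact: powR_ge0.
have step k : bessel_symbol n%:R <=
    (\int[mu]_y ((4 ^+ k) `^ (s / 2) * (G y * gauss k y)))%R.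
  rewrite RintegralZl; [|by []|exact: integrable_kernel_gauss].
  apply: le_trans (ler_wpM2l (c0 k) (kernel_gauss k)).
  have k1 : 1 <= 4 ^+ k :> R by rewrite exprn_ege1 // ler1n.
  have kn : 0 <= n%:R * 4 ^+ k :> R by rewrite mulr_ge0 // exprn_ge0.
  have p0 := bessel_base_gt0 _ kn; have p1 := bessel_base_gt0 _ (ler0n R n).
  (* 1 + 4 pi^2 n 4^k <= 4^k (1 + 4 pi^2 n) *)
  rewrite /bessel_symbol -ler_pdivrMl ?powR_gt0 ?exprn_gt0 // -powRN.
  rewrite -powRM ?exprn_ge0 ?(ltW p1) //.
  apply: gt0_ler_powRN => //; first by rewrite divr_ge0 // ltW.
  have : 0 <= 4 * pi ^+ 2 * n%:R :> R by rewrite mulr_ge0 // mulr_ge0 // sqr_ge0.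
  by rewrite mulrA; nra.
have ik k : mu.-integrable setT (EFin \o (fun y => (4 ^+ k) `^ (s / 2) * (G y * gauss k y))).
  have := integrableZl measurableT ((4 ^+ k) `^ (s / 2)) (integrable_kernel_gauss k).
  by apply: eq_integrable => // y _; rewrite /= EFinM.
pose S K y := \sum_(k < K) (4 ^+ k) `^ (s / 2) * (G y * gauss k y).
have iS L : mu.-integrable setT (EFin \o S L).
  elim: L => [|L IH].
    apply: (eq_integrable measurableT _ _ _ (integrable0 _ _)) => y _.
    by rewrite /S /= big_ord0.
  apply: (eq_integrable measurableT _ _ _ (integrableD measurableT IH (ik L))) => y _.
  by rewrite /S /= big_ord_recr.
rewrite (@eq_Rintegral _ _ _ mu setT (S K)); last first.
  by move=> y _; rewrite mulr_sumr; apply: eq_bigr => k _; rewrite mulrCA.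
elim: K => [|K IH].
  by rewrite mul0r; apply: Rintegral_ge0 => y _; rewrite /S big_ord0.
rewrite -addn1 natrD mulrDl mul1r.
rewrite (@eq_Rintegral _ _ _ mu setT
  (fun y => S K y + (4 ^+ K) `^ (s / 2) * (G y * gauss K y))); last first.
  by move=> y _; rewrite addn1 /S big_ord_recr.
by rewrite RintegralD //; apply: lerD.
Qed.

(** The divergence of [int G(y) |y|^(-s) dy], in quantitative form. *)
Lemma kernel_mollified : exists2 c : R, 0 < c & forall K,
  c * K%:R <= (\int[mu]_y (G y * mollified K y `^ (- (s / 2))))%R.
Proof.
have [C C0 CP] := sum_powR_gauss_le (s / 2) (divr_gt0 s0 (ltr0Sn _ 1)).
have b0 : 0 < bessel_symbol n%:R.
  by rewrite powR_gt0 // bessel_base_gt0.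
have D0 : 0 < C * expR 1 by rewrite mulr_gt0 // expR_gt0.
exists (bessel_symbol n%:R / (C * expR 1)); first by rewrite divr_gt0.
move=> K; rewrite mulrAC ler_pdivrMr // [leLHS]mulrC [leRHS]mulrC.
apply: le_trans (kernel_sum_gauss K) _.
have iw := integrable_kernel_mollified K.
rewrite -RintegralZl //; apply: le_Rintegral => //.
- apply: (integrable_kernelM _ (\sum_(k < K) (4 ^+ k) `^ (s / 2))).
    apply: measurable_sum => k; apply: measurable_funM => //.
    exact: measurable_gauss.
  move=> y; rewrite ger0_norm; last first.
    by apply: sumr_ge0 => k _; rewrite mulr_ge0 ?powR_ge0 // expR_ge0.
  apply: ler_sum => k _; rewrite ler_piMr ?powR_ge0 //.
  by have /andP[] := gauss_bounds k y.
- have := integrableZl measurableT (C * expR 1) iw.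
  by apply: eq_integrable => // y _; rewrite /= EFinM.
move=> y _; rewrite mulrCA ler_wpM2l //.
have w0 := mollified_gt0 K y; set w := mollified K y.
rewrite powRN -[leRHS]mulrC -ler_pdivrMl ?invr_gt0 ?powR_gt0 // invrK.
apply: (@le_trans _ _ (\sum_(k < K) (4 ^+ k * w) `^ (s / 2) *
    expR (- (4 ^+ k * w)) * expR 1)); last first.
  by rewrite -mulr_suml ler_wpM2r ?expR_ge0 // CP.
rewrite mulr_sumr; apply: ler_sum => k _.
rewrite powRM ?exprn_ge0 ?(ltW w0) // mulrA [w `^ _ * _]mulrC -mulrA.
rewrite ler_wpM2l ?mulr_ge0 ?powR_ge0 // -expRD ler_expR.
(* since k < K, cutting the distance off costs at most a factor exp 1 *)
rewrite /w /mollified mulrDr opprD.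
have : 4 ^+ k * 4 ^- K <= 1 :> R.
  rewrite ler_pdivrMr ?exprn_gt0 // mul1r.
  by apply: ler_weXn2l; [rewrite ler1n|exact: ltnW].
lra.
Qed.

End kernel.

(** * Growth of the potential of the test functions *)

Section potential.
Context {R : realType} {n : nat}.
Local Notation mu := (@lebesgue_rV R n).

Lemma Re_le_normc (z : R[i]) : complex.Re z <= normc z.
Proof.
case: z => a b /=; rewrite (le_trans (ler_norm a)) // -sqrtr_sqr.
by rewrite ler_wsqrtr // lerDl sqr_ge0.
Qed.

(** If [|x| <= 2^-K] and [|y| <= 1/2], then [x - y] and [x + y] lie in the unit
    ball and their cut-off squared distances are at most three times that of [y].
    For [|y| > 1/2] the subtracted constant makes the left-hand side negative. *)
Lemma bump_mul_ge (a b : R) K (x y : 'rV[R]_n) : 0 <= a -> 0 <= b -> (0 < K)%N ->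
  dotrV x x <= 4 ^- K ->
  3 `^ (- (n%:R * (a + b) / 2)) *
   (mollified K y `^ (- (n%:R * (a + b) / 2)) - 4 `^ (n%:R * (a + b) / 2)) <=
  bump a K (x - y) * bump b K (x + y).
Proof.
move=> a0 b0 K0 xK; set t := n%:R * (a + b) / 2.
have t0 : 0 <= t by rewrite divr_ge0 // mulr_ge0 // addr_ge0.
have w0 := mollified_gt0 K y.
have Kinv : 0 < 4 ^- K :> R by rewrite invr_gt0 exprn_gt0.
have [y4|y4] := leP (dotrV y y) 4^-1; last first.
  apply: (@le_trans _ _ 0); last by rewrite mulr_ge0 ?bump_ge0.
  rewrite mulr_ge0_le0 ?powR_ge0 // subr_le0.
  have -> : 4 `^ t = (4^-1) `^ (- t) :> R.
    by rewrite -powR_inv1 // -powRrM mulN1r opprK.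
  apply: gt0_ler_powRN => //.
  by rewrite (le_trans (ltW y4)) // /mollified lerDr ltW.
have K4 : 4 ^- K <= 4^-1 :> R.
  rewrite lef_pV2 ?posrE ?exprn_gt0 // -[leLHS]expr1.
  by apply: ler_weXn2l; rewrite ?ler1n.
have x4 := le_trans xK K4.
have key (e : bool) c : 0 <= c -> (3 * mollified K y) `^ (- (n%:R * c / 2)) <=
    bump c K (x + (-1) ^+ e *: y).
  move=> c0; have le2 := dotrVDB_le e x y.
  have le1 : dotrV (x + (-1) ^+ e *: y) (x + (-1) ^+ e *: y) <= 1 by lra.
  rewrite /bump le1 mulr1.
  apply: gt0_ler_powRN; [by rewrite divr_ge0 // mulr_ge0|exact: mollified_gt0|].
  move: le2 xK (dotrV_ge0 y); rewrite /mollified; lra.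
have := key true _ a0; have := key false _ b0.
rewrite /= expr0 scale1r expr1 scaleN1r => H1 H2.
apply: (@le_trans _ _ (3 `^ (- t) * mollified K y `^ (- t))).
  by rewrite ler_wpM2l ?powR_ge0 // gerBl powR_ge0.
rewrite -powRM ?(ltW w0) //.
have -> : - t = - (n%:R * a / 2) + - (n%:R * b / 2) by rewrite /t; field.
rewrite powRD; last by rewrite mulf_neq0 ?(gt_eqF w0) ?implybT.
by apply: ler_pM; rewrite ?powR_ge0.
Qed.

Lemma potential_bump_ge (s : R) (G : 'rV[R]_n -> R) (a b : R) :
  0 < s -> 0 <= a -> 0 <= b -> n%:R * (a + b) = s -> is_bessel_kernel s G ->
  exists c B : R, [/\ 0 < c, 0 <= B & forall K (x : 'rV[R]_n), (0 < K)%N ->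
    dotrV x x <= 4 ^- K ->
    c * K%:R - B <= normc (bilinear_potential G
      (fun x => (bump a K x)%:C)%C (fun x => (bump b K x)%:C)%C x)].
Proof.
move=> s0 a0 b0 abs GP; have [G0 iG _] := GP.
have [c c0 cP] := kernel_mollified _ _ s0 GP.
pose I := (\int[mu]_y G y)%R.
have I0 : 0 <= I by apply: Rintegral_ge0 => y _; exact: G0.
pose m : R := 3 `^ (- (s / 2)).
have m0 : 0 < m by rewrite powR_gt0.
exists (m * c), (m * (4 `^ (s / 2) * I)); split.
- by rewrite mulr_gt0.
- by rewrite !mulr_ge0 ?powR_ge0.
move=> K x K0 xK; apply: le_trans (Re_le_normc _).
rewrite /bilinear_potential /cintegral /=.
have -> : (\int[mu]_y complex.Re (bilinear_integrand G
      (fun x => (bump a K x)%:C)%C (fun x => (bump b K x)%:C)%C x y))%R =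
    (\int[mu]_y (G y * (bump a K (x - y) * bump b K (x + y))))%R.
  by apply: eq_Rintegral => y _; rewrite /= !(mul0r, mulr0, subr0, addr0) mulrA.
have iw := integrable_kernel_mollified _ _ s0 GP K.
have i4 : mu.-integrable setT (EFin \o (fun y => 4 `^ (s / 2) * G y)).
  have := integrableZl measurableT (4 `^ (s / 2)) iG.
  by apply: eq_integrable => // y _; rewrite /= EFinM.
have iD : mu.-integrable setT (EFin \o (fun y =>
    G y * mollified K y `^ (- (s / 2)) - 4 `^ (s / 2) * G y)).
  have := integrableB measurableT iw i4.
  by apply: eq_integrable => // y _; rewrite /= EFinB.
apply: (@le_trans _ _ (\int[mu]_y (m *
   (G y * mollified K y `^ (- (s / 2)) - 4 `^ (s / 2) * G y)))%R).
  rewrite RintegralZl // RintegralB // RintegralZl // -mulrA -mulrBr.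
  by rewrite ler_pM2l // lerD2r cP.
apply: le_Rintegral => //.
- have := integrableZl measurableT m iD.
  by apply: eq_integrable => // y _; rewrite /= EFinM.
- apply: (integrable_kernelM _ _ GP _
    ((4 ^- K) `^ (- (n%:R * a / 2)) * (4 ^- K) `^ (- (n%:R * b / 2)))).
    apply: measurable_funM; apply: (measurableT_comp (measurable_bump _ _)).
      by apply: measurable_rVD => //; exact: measurable_rVN.
    exact: measurable_rVD.
  move=> y; rewrite normrM !(ger0_norm (bump_ge0 _ _ _)).
  by apply: ler_pM; rewrite ?bump_ge0 ?bump_le_powR.
move=> y _; have := bump_mul_ge a b K x y a0 b0 K0 xK; rewrite abs -/m => H.
apply: le_trans (ler_wpM2l (G0 y) H).
by rewrite le_eqVlt; apply/orP; left; apply/eqP; ring.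
Qed.

(** The ball contains a cube, which has positive measure. *)
Lemma le_cLnormy (h : 'rV[R]_n -> R[i]) (r v : R) :
  0 < r -> (forall x, dotrV x x <= r -> v <= normc (h x)) ->
  (v%:E <= cLnorm +oo%E h)%E.
Proof.
move=> r0 hv; rewrite /cLnorm unlock lebesgue_rV_gt0.
rewrite leNgt; apply/negP => lt.
(* the minimum with 1 makes the square of the half-side at most r / (n + 1) *)
have /negligibleS : cube n (Num.min 1 (r / n.+1%:R)) `<=`
    ~` [set x : 'rV[R]_n | (`|(normc (h x))%:E| <=
      ess_sup mu (abse \o (fun x => (normc (h x))%:E)))%E].
  move=> x xc /=; apply/negP; rewrite -ltNge (lt_le_trans lt) // lee_fin.
  apply: le_trans (ler_norm _); apply: hv.
  have n0 : 0 < n.+1%:R :> R by rewrite ltr0n.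
  apply: (@le_trans _ _ (\sum_(i < n) r / n.+1%:R)).
    apply: ler_sum => i _; have := xc i; rewrite le_min => /andP[x1 xr].
    rewrite -expr2 -real_normK ?num_real // expr2.
    by rewrite (le_trans _ xr) // ler_piMl.
  rewrite sumr_const card_ord -[leLHS]mulr_natr mulrAC ler_pdivrMr //.
  by rewrite ler_pM2l // ler_nat.
have m0 : 0 < Num.min 1 (r / n.+1%:R) :> R.
  by rewrite lt_min ltr01 divr_gt0 // ltr0n.
move=> /(_ _ mu (ess_sup_ge _ _)) /(measure_negligible (measurable_cube _ _)).
move=> E; have := lebesgue_cube n _ m0; rewrite E => /eqP.
by rewrite eqe eq_sym gt_eqF // exprn_gt0 // mulr_gt0.
Qed.

End potential.

Theorem proposition7p1 (R : realType) (n : nat) (s : R) (p q : \bar R)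
    (G : 'rV[R]_n -> R) :
  (1 <= n)%N -> 0 < s < n%:R ->
  (1 <= p)%E -> (1 <= q)%E ->
  (p^-1 + q^-1 = (s / n%:R)%:E)%E ->
  ~ (p = +oo%E /\ q = +oo%E) ->
  is_bessel_kernel s G ->
  ~ bounded_bilinear G p q +oo%E.
Proof.
move=> n1 /andP[s0 sn] p1 q1 pq _ GP [C bdd].
have n0 : 0 < n%:R :> R by rewrite ltr0n.
have p0 : (0 <= p^-1)%E by rewrite inve_ge0 (le_trans _ p1).
have q0 : (0 <= q^-1)%E by rewrite inve_ge0 (le_trans _ q1).
have sum : fine p^-1%E + fine q^-1%E = s / n%:R.
  by move: pq; case: (p^-1)%E => [u| |] /=; case: (q^-1)%E => [v| |] /= [].
have a0 := fine_ge0 p0; have b0 := fine_ge0 q0.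
have Hf K := cLfun_bump (n := n) p K p1; have Hg K := cLfun_bump (n := n) q K q1.
have Nf K := cLnorm_bump (n := n) p K p1; have Ng K := cLnorm_bump (n := n) q K q1.
move: sum a0 b0 Hf Hg Nf Ng; set a := fine p^-1%E; set b := fine q^-1%E.
move=> sum a0 b0 Hf Hg Nf Ng.
have abs : n%:R * (a + b) = s by rewrite sum mulrC divfK // gt_eqF.
have [c [B [c0 B0 JP]]] := potential_bump_ge _ _ _ _ s0 a0 b0 abs GP.
have r01 : 0 <= a + b < 1 by rewrite addr_ge0 //= sum ltr_pdivrMr // mul1r.
have [K KP] := sublinear_lt_linear c (a + b) B `|C| (4 ^+ n) c0 r01
  (exprn_gt0 _ (ltr0Sn _ _)).
set L : R := 4 ^+ n * K.+1%:R in KP.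
(* KP fails for K = 0, where its right-hand side is - B <= 0 *)
have K0 : (0 < K)%N.
  rewrite lt0n; apply/eqP => K0; move: KP; rewrite K0 mulr0 sub0r.
  have : 0 <= `|C| * L `^ (a + b) by rewrite mulr_ge0 ?powR_ge0.
  lra.
have [_] := bdd _ _ (Hf K) (Hg K).
apply/negP; rewrite -ltNge.
have L0 : 0 < L by rewrite mulr_gt0 ?exprn_gt0 // ltr0n.
apply: (@le_lt_trans _ _ (`|C| * L `^ (a + b))%:E).
  apply: (@le_trans _ _ (`|C|%:E * (cLnorm p (fun x : 'rV[R]_n => (bump a K x)%:C%C) *
      cLnorm q (fun x : 'rV[R]_n => (bump b K x)%:C%C))))%E.
    by rewrite lee_wpmul2r ?mule_ge0 ?Lnorm_ge0 // lee_fin ler_norm.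
  rewrite EFinM lee_wpmul2l ?lee_fin //.
  rewrite powRD ?(gt_eqF L0) ?implybT // EFinM.
  by apply: lee_pmul; rewrite ?Lnorm_ge0 ?Nf ?Ng.
apply: (@lt_le_trans _ _ (c * K%:R - B)%:E); first by rewrite lte_fin.
apply: (le_cLnormy _ (4 ^- K)); first by rewrite invr_gt0 exprn_gt0.
by move=> x xK; exact: JP.
Qed.
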